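(* Let $N,r,n$ be positive integers and, for $e\ge 0$, let $$ D_r(e)=\sum_{\substack{i_1+\cdots+i_r=e\\ i_1,\dots,i_r\ge 0}}\frac{N^r}{(N+i_1)\cdots(N+i_r)}. $$ Then: (1) $$c_{N,n}^{(r)}=n!\sum_{t_1+2t_2+\cdots+nt_n=n}\binom{t_1+\cdots+t_n}{t_1,\dots,t_n}(-1)^{n-t_1-\cdots-t_n}D_r(1)^{t_1}D_r(2)^{t_2}\cdots D_r(n)^{t_n},$$ where the sum is over nonnegative integers $t_1,\dots,t_n$ and $\binom{t_1+\cdots+t_n}{t_1,\dots,t_n}=\frac{(t_1+\cdots+t_n)!}{t_1!\cdots t_n!}$; (2) $$D_r(n)=\det\begin{pmatrix}\frac{c_{N,1}^{(r)}}{1!}&1&&\\ \frac{c_{N,2}^{(r)}}{2!}&\ddots&\ddots&\\ \vdots&\ddots&\ddots&1\\ \frac{c_{N,n}^{(r)}}{n!}&\cdots&\frac{c_{N,2}^{(r)}}{2!}&\frac{c_{N,1}^{(r)}}{1!}\end{pmatrix},$$ the $n\times n$ matrix with $(i,j)$ entry $c_{N,i-j+1}^{(r)}/(i-j+1)!$ for $j\le i$, $1$ for $j=i+1$, $0$ for $j\ge i+2$; (3) the $(n+1)\times(n+1)$ lower triangular matrix with $(i,j)$ entry $c_{N,i-j}^{(r)}/(i-j)!$ for $i\ge j$ (and $0$ otherwise), $0\le i,j\le n$, is invertible and its inverse is the $(n+1)\times(n+1)$ lower triangular matrix with $(i,j)$ entry $D_r(i-j)$ for $i\ge j$, where $D_r(0)=1$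 (diagonal entries $1$) and $0$ otherwise.
   Context: For positive integers $N$ and $r$, the (multiple) hypergeometric Cauchy numbers $c_{N,n}^{(r)}$ ($n\ge0$) are defined by the formal power series identity $$\frac{1}{\bigl({}_2F_1(1,N;N+1;-x)\bigr)^r}=\left(\frac{(-1)^{N-1}x^N/N}{\log(1+x)-\sum_{k=1}^{N-1}(-1)^{k-1}x^k/k}\right)^r=\sum_{n=0}^\infty c_{N,n}^{(r)}\frac{x^n}{n!},$$ where ${}_2F_1(a,b;c;z)=\sum_{n\ge0}\frac{(a)^{(n)}(b)^{(n)}}{(c)^{(n)}}\frac{z^n}{n!}$ is the Gauss hypergeometric function and $(x)^{(n)}=x(x+1)\cdots(x+n-1)$, $(x)^{(0)}=1$. Note $c_{N,0}^{(r)}=1$.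
   Formalization: In part (3) the inverse matrix is stated with entries (-1)^(i-j) D_r(i-j) instead of D_r(i-j); without the sign the claim fails for all N, r, n ≥ 1 (e.g. N=r=n=1, where c_{1,1}=D_1(1)=1/2). *)

(* Defs.v *)
From mathcomp Require Import all_boot all_order all_algebra.
Set Implicit Arguments.
Unset Strict Implicit.
Unset Printing Implicit Defensive.
Import Order.TTheory GRing.Theory Num.Theory.
Local Open Scope ring_scope.

(* A formal power series is represented by its sequence of coefficients. *)
Definition fps (F : fieldType) := nat -> F.

Definition fps_one (F : fieldType) : fps F := fun n => (n == 0%N)%:R.

Definition fps_mul (F : fieldType) (f g : fps F) : fps F :=
  fun n => \sum_(i < n.+1) f i * g (n - i)%N.

Definition fps_exp (F : fieldType) (f : fps F) (r : nat) : fps F :=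
  iter r (fps_mul f) (fps_one F).

(* First n coefficients of 1 / f, obtained by solving f * g = 1 degree by
   degree. *)
Fixpoint fps_inv_prefix (F : fieldType) (f : fps F) (n : nat) : seq F :=
  if n is m.+1 then
    let s := fps_inv_prefix f m in
    rcons s (((m == 0%N)%:R - \sum_(i < m) f (m - i)%N * s`_i) / f 0%N)
  else [::].

(* Multiplicative inverse; meaningful when f 0 != 0 (see fps_mulV). *)
Definition fps_inv (F : fieldType) (f : fps F) : fps F :=
  fun n => (fps_inv_prefix f n.+1)`_n.

(* The series f(-x). *)
Definition fps_compN (F : fieldType) (f : fps F) : fps F :=
  fun n => (-1) ^+ n * f n.

Definition rising (F : fieldType) (x : F) (n : nat) : F :=
  \prod_(k < n) (x + k%:R).

(* Gauss series 2F1(a, b; c; z) as a formal power series in z. *)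
Definition hyp2F1 (F : fieldType) (a b c : F) : fps F :=
  fun n => rising a n * rising b n / rising c n / n`!%:R.

(* c_{N,n}^{(r)}: n! times the coefficient of x^n in
   1 / (2F1(1, N; N + 1; -x))^r. *)
Definition hgCauchy (N r n : nat) : rat :=
  n`!%:R * fps_inv (fps_exp (fps_compN (hyp2F1 1 N%:R N.+1%:R)) r) n.

(* D_r(e), with N explicit. In i_1 + ... + i_r = e every i_k is at most e,
   so the index functions may be taken with values in 'I_e.+1.
   Pitfall: the coefficient of x^e in (2F1(1, N; N + 1; -x))^r is
   (-1)^e D_r(e), not D_r(e); hence the inverse of the Toeplitz matrix of the
   c_{N,k}^{(r)} / k! has entries (-1)^(i-j) D_r(i-j). Without the sign this
   fails already for N = r = 1 in size 2, where c_{1,1}^{(1)} = D_1(1) = 1/2. *)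
Definition Dsum (N r e : nat) : rat :=
  \sum_(i : {ffun 'I_r -> 'I_e.+1} | (\sum_k i k)%N == e)
     N%:R ^+ r / \prod_k (N + i k)%:R.

Lemma size_fps_inv_prefix (F : fieldType) (f : fps F) n :
  size (fps_inv_prefix f n) = n.
Proof. by elim: n => //= n IH; rewrite size_rcons IH. Qed.

Lemma nth_fps_inv_prefix (F : fieldType) (f : fps F) n i :
  (i < n)%N -> (fps_inv_prefix f n)`_i = fps_inv f i.
Proof.
elim: n => // n IH; rewrite ltnS leq_eqVlt => /orP[/eqP-> //|lt_in].
by rewrite /= nth_rcons size_fps_inv_prefix lt_in IH.
Qed.

Lemma fps_invE (F : fieldType) (f : fps F) n :
  fps_inv f n =
  ((n == 0%N)%:R - \sum_(i < n) f (n - i)%N * fps_inv f i) / f 0%N.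
Proof.
rewrite {1}/fps_inv /= nth_rcons size_fps_inv_prefix ltnn eqxx.
by congr ((_ - _) / _); apply: eq_bigr => i _; rewrite nth_fps_inv_prefix.
Qed.

Lemma fps_mulV (F : fieldType) (f : fps F) :
  f 0%N != 0 -> fps_mul (fps_inv f) f =1 fps_one F.
Proof.
move=> f0 n; rewrite /fps_mul big_ord_recr /= subnn [fps_inv f n]fps_invE divfK //.
by under eq_bigr do rewrite mulrC; rewrite addrC subrK.
Qed.

Lemma fps_exp0 (F : fieldType) (f : fps F) r : fps_exp f r 0%N = f 0%N ^+ r.
Proof.
elim: r => //= r IH; rewrite /fps_exp /= -/(fps_exp f r) /fps_mul.
by rewrite big_ord1 IH exprS.
Qed.

Lemma rising1 (m : nat) : rising (1 : rat) m = m`!%:R.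
Proof.
elim: m => [|m IH]; first by rewrite /rising big_ord0.
by rewrite /rising big_ord_recr /= -/(rising _ _) IH nat1r factS natrM mulrC.
Qed.

Lemma rising_shift (N m : nat) :
  rising (N%:R : rat) m * (N + m)%:R = N%:R * rising N.+1%:R m.
Proof.
elim: m => [|m IH]; first by rewrite /rising !big_ord0 addn0 mul1r mulr1.
rewrite /rising !big_ord_recr /= -!/(rising _ _) -natrD IH.
by rewrite -natrD addSnnS mulrA.
Qed.

Lemma gaussE (N m : nat) : (0 < N)%N ->
  fps_compN (hyp2F1 (1 : rat) N%:R N.+1%:R) m
  = (-1) ^+ m * (N%:R / (N + m)%:R).
Proof.
move=> N0; congr (_ * _); rewrite /hyp2F1 rising1.
have m0 : (m`!%:R : rat) != 0 by rewrite pnatr_eq0 -lt0n fact_gt0.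
have c0 : rising (N.+1%:R : rat) m != 0.
  by apply/prodf_neq0 => k _; rewrite -natrD pnatr_eq0.
have d0 : ((N + m)%:R : rat) != 0 by rewrite pnatr_eq0 -lt0n addn_gt0 N0.
rewrite [m`!%:R * _]mulrC (mulrAC _ m`!%:R) mulfK //.
by apply/eqP; rewrite eqr_div // rising_shift.
Qed.

Lemma hgCauchyP (N r : nat) : (0 < N)%N ->
  fps_mul (fun n => hgCauchy N r n / n`!%:R)
          (fps_exp (fps_compN (hyp2F1 1 N%:R N.+1%:R)) r) =1 fps_one rat.
Proof.
move=> N0 n; set G := fps_exp _ _.
rewrite -(@fps_mulV _ G) {}/G; last first.
  rewrite fps_exp0 gaussE // addn0 expr0 mul1r divff ?expr1n ?oner_eq0 //.
  by rewrite pnatr_eq0 -lt0n.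
apply: eq_bigr => i _; congr (_ * _); rewrite /hgCauchy mulrC mulKf //.
by rewrite pnatr_eq0 -lt0n fact_gt0.
Qed.

(* ((-1)^(N-1) x^N / N) * 2F1(1, N; N+1; -x)
   = log(1+x) - \sum_(1 <= k < N) (-1)^(k-1) x^k / k. *)
Lemma gauss_log (N : nat) : (0 < N)%N ->
  fps_mul (fun n => if n == N then (-1) ^+ N.-1 / N%:R else 0)
          (fps_compN (hyp2F1 (1 : rat) N%:R N.+1%:R))
  =1 (fun n => if (n < N)%N then 0 else (-1) ^+ n.-1 / n%:R).
Proof.
move=> N0 n; rewrite /fps_mul; case: ltnP => [lt_nN|le_Nn].
  apply: big1 => i _; rewrite ifN ?mul0r // neq_ltn.
  by rewrite (leq_trans (ltn_ord i)).
have lt_Nn : (N < n.+1)%N by [].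
rewrite (bigD1 (Ordinal lt_Nn)) //= eqxx big1 => [|i ne_iN]; last first.
  by rewrite ifN ?mul0r //; move: ne_iN; rewrite -val_eqE.
rewrite addr0 gaussE // subnKC //.
have -> : n.-1 = (N.-1 + (n - N))%N by rewrite -[in LHS](subnKC le_Nn) -{1}(prednK N0).
rewrite exprD -!mulrA; congr (_ * _); rewrite mulrCA; congr (_ * _).
by rewrite mulrA mulVf ?mul1r // pnatr_eq0 -lt0n.
Qed.

(* Main.v *)
(* Write G = 2F1(1, N; N + 1; -x). Its e-th coefficient is
   (-1)^e N / (N + e), so G^r = \sum_e (-1)^e D_r(e) x^e, and the series of the
   c_{N,k}^{(r)} / k! is the inverse of G^r. Part (3) holds because
   lower triangular Toeplitz matrices multiply like power series; part (2) is
   Cramer's rule for that inverse; part (1) is the geometric series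
   1 / (1 - u) = \sum_k u^k with u = 1 - G^r, each u^k being expanded by the
   multinomial theorem. *)
Require Import Defs.
From mathcomp Require Import all_boot all_order all_algebra.
Import Order.TTheory GRing.Theory Num.Theory.
Local Open Scope ring_scope.

(** Stands in for arithmetic modulo ['X^n.+1]. *)
Lemma eq_coefM (R : nzRingType) (p q p' q' : {poly R}) (n : nat) :
  (forall i, (i <= n)%N -> p`_i = p'`_i) ->
  (forall i, (i <= n)%N -> q`_i = q'`_i) -> (p * q)`_n = (p' * q')`_n.
Proof.
move=> eqp eqq; rewrite !coefM; apply: eq_bigr => i _.
by rewrite eqp ?eqq ?leq_subr // -ltnS.
Qed.

(** Truncation beyond degree [m] cannot affect coefficients up to [m]. Keeping the cutoff
    independent of [e] lets the induction hypothesis apply to every lower degree. *)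
Lemma fps_exp_coef (F : fieldType) (f : fps F) (r m e : nat) : (e <= m)%N ->
  fps_exp f r e = ((\poly_(i < m.+1) f i) ^+ r)`_e.
Proof.
elim: r e => [|r IH] e le_em; first by rewrite expr0 coef1.
rewrite exprS coefM; apply: eq_bigr => i _.
have le_ie : (i <= e)%N by rewrite -ltnS.
rewrite coef_poly ltnS (leq_trans le_ie le_em) -IH //.
exact: leq_trans (leq_subr _ _) le_em.
Qed.

Lemma fps_exp_sum (F : fieldType) (f : fps F) (r e : nat) :
  fps_exp f r e =
  \sum_(i : {ffun 'I_r -> 'I_e.+1} | (\sum_k i k)%N == e) \prod_k f (i k).
Proof.
rewrite (@fps_exp_coef _ _ _ e) // poly_def.
(* Distributivity chooses one monomial in each of the [r] factors; the choices of total degree [e]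
   survive. *)
rewrite -[r in X in X`_e]card_ord -prodr_const bigA_distr_bigA /= coef_sum.
rewrite [RHS]big_mkcond; apply: eq_bigr => i _.
rewrite scaler_prod prodrXr coefZ coefXn eq_sym.
by case: eqP; rewrite ?mulr1 ?mulr0.
Qed.

Lemma prodr_signM (R : comNzRingType) (I : finType) (k : I -> nat)
    (x : I -> R) :
  \prod_i ((-1) ^+ k i * x i) = (-1) ^+ (\sum_i k i)%N * \prod_i x i.
Proof. by rewrite big_split prodrXr. Qed.

Lemma gauss_exp_Dsum (N r e : nat) : (0 < N)%N ->
  fps_exp (fps_compN (hyp2F1 (1 : rat) N%:R N.+1%:R)) r e
  = (-1) ^+ e * Dsum N r e.
Proof.
move=> N0; rewrite fps_exp_sum big_distrr /=; apply: eq_bigr => i /eqP sum_i.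
under eq_bigr do rewrite gaussE //.
rewrite prodr_signM sum_i big_split /= prodr_const card_ord.
by rewrite -prodfV.
Qed.

Definition fps_toeplitz (F : fieldType) (m : nat) (f : fps F) : 'M[F]_m :=
  \matrix_(i, j) if (j <= i)%N then f (i - j)%N else 0.

Lemma fps_toeplitz1 (F : fieldType) (m : nat) :
  fps_toeplitz F m (fps_one F) = 1%:M.
Proof.
apply/matrixP => i j; rewrite !mxE /fps_one -val_eqE /=.
case: leqP => [le_ji|lt_ij]; last by rewrite ltn_eqF.
by rewrite subn_eq0 eqn_leq le_ji andbT.
Qed.

(** Only [j <= k <= i] contributes to entry [(i, j)]; shifting [k] by [j] leaves a convolution led
    by [g], hence the swapped factors. *)
Lemma fps_toeplitzM (F : fieldType) (m : nat) (f g : fps F) :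
  fps_toeplitz F m f *m fps_toeplitz F m g = fps_toeplitz F m (fps_mul g f).
Proof.
apply/matrixP => i j; rewrite !mxE.
under eq_bigr do rewrite !mxE.
case: leqP => [le_ji|lt_ij]; last first.
  apply: big1 => k _; case: leqP => [le_ki|_]; last by rewrite mul0r.
  by rewrite leqNgt (leq_ltn_trans le_ki lt_ij) mulr0.
pose h k := (if (k <= i)%N then f (i - k)%N else 0) *
            (if (j <= k)%N then g (k - j)%N else 0).
rewrite -(big_mkord xpredT h) (@big_cat_nat _ _ _ j) //= ?(ltnW (ltn_ord j)) //.
rewrite (@big_cat_nat _ _ _ i.+1 j) //= ?(leqW le_ji) //.
rewrite [X in X + _]big_nat_cond [X in X + _]big1; last first.
  by move=> k /andP[/andP[_ lt_kj] _]; rewrite /h (leqNgt j) lt_kj mulr0.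
rewrite [X in _ + (_ + X)]big_nat_cond [X in _ + (_ + X)]big1; last first.
  by move=> k /andP[/andP[lt_ik _] _]; rewrite /h (leqNgt k) lt_ik mul0r.
rewrite add0r addr0 -[X in \sum_(X <= _ < _) _]add0n big_addn subSn //.
rewrite big_mkord /fps_mul; apply: eq_bigr => k _.
have le_k : (k + j <= i)%N by rewrite addnC -leq_subRL // -ltnS.
by rewrite /h le_k leq_addl addnK addnC subnDA mulrC.
Qed.

Lemma det_fps_toeplitz (F : fieldType) (m : nat) (f : fps F) :
  \det (fps_toeplitz F m f) = f 0%N ^+ m.
Proof.
rewrite det_trig.
  rewrite -[m in RHS]card_ord -prodr_const; apply: eq_bigr => i _.
  by rewrite mxE leqnn subnn.
by apply/is_trig_mxP => i j lt_ij; rewrite mxE leqNgt lt_ij.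
Qed.

(* Deleting the first row and last column of the (n+1) x (n+1) Toeplitz matrix
   of f gives the Hessenberg matrix, so Cramer's rule reads its determinant off
   the corner entry of the inverse, which is the Toeplitz matrix of g. *)
Lemma det_hessenberg_toeplitz (F : fieldType) (n : nat) (f g : fps F) :
  f 0%N = 1 -> fps_mul g f =1 fps_one F ->
  \det (\matrix_(i < n, j < n)
          (if (j <= i)%N then f (i - j + 1)%N
           else if j == i.+1 :> nat then 1 else 0)) = (-1) ^+ n * g n.
Proof.
move=> f0 gf.
set T := fps_toeplitz F n.+1 f; set H := (X in \det X).
have T1 : T *m fps_toeplitz F n.+1 g = 1%:M.
  rewrite fps_toeplitzM -fps_toeplitz1; apply/matrixP => i j.
  by rewrite !mxE gf.
have [uT _] := mulmx1_unit T1.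
have invT : invmx T = fps_toeplitz F n.+1 g.
  by rewrite -[LHS]mulmx1 -T1 mulKmx.
have := congr1 (fun A : 'M__ => A ord_max ord0) invT.
rewrite /invmx uT det_fps_toeplitz f0 expr1n invr1 scale1r !mxE leq0n subn0.
rewrite /cofactor /= add0n => <-; rewrite mulrA -exprD addnn.
rewrite -signr_odd odd_double mul1r.
(* Deleting row 0 raises the row index by one, so the entries at [j = i.+1] come from the diagonal
   of [T], where [f 0 = 1]. *)
congr (\det _); apply/matrixP => i j; rewrite !mxE lift0 lift_max.
case: leqP => [le_ji|lt_ij]; first by rewrite (leqW le_ji) subSn // addn1.
case: eqP => [->|/eqP ne]; first by rewrite leqnn subnn f0.
by rewrite leqNgt ltn_neqAle eq_sym ne lt_ij.
Qed.

(** The binomial theorem divided by [k!], which is the coefficient form of exp(xY) exp(yY) = exp((x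
    + y)Y). *)
Lemma exprDn_fact (F : numFieldType) (A : comAlgType F) (x y : A) (k : nat) :
  \sum_(i < k.+1) ((i`!%:R : F)^-1 *: x ^+ i) *
                  (((k - i)`!%:R : F)^-1 *: y ^+ (k - i))
  = (k`!%:R : F)^-1 *: (x + y) ^+ k.
Proof.
rewrite addrC exprDn scaler_sumr; apply: eq_bigr => i _.
rewrite -scalerAl -scalerAr scalerA -[_ *+ 'C(_, _)]scaler_nat scalerA.
rewrite [y ^+ _ * _]mulrC; congr (_ *: _).
have le_ik : (i <= k)%N by rewrite -ltnS.
have nz m : (m`!%:R : F) != 0 by rewrite pnatr_eq0 -lt0n fact_gt0.
rewrite -(bin_fact le_ik) !natrM invfM mulrAC mulVf ?mul1r ?invfM //.
by rewrite pnatr_eq0 -lt0n bin_gt0.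
Qed.

(* Both sides are k! times the coefficient of Y^k in the product of the
   truncated exponentials of the x_i Y. *)
Lemma multinomial_expansion (F : numFieldType) (A : comAlgType F)
    (n m k : nat) (x : 'I_n -> A) : (k <= m)%N ->
  (\sum_i x i) ^+ k =
  \sum_(t : {ffun 'I_n -> 'I_m.+1} | (\sum_i t i)%N == k)
     (k`!%:R / \prod_i (t i)`!%:R : F) *: \prod_i x i ^+ t i.
Proof.
move=> le_km.
pose E (y : A) : {poly A} := \poly_(j < m.+1) ((j`!%:R : F)^-1 *: y ^+ j).
(* Up to degree [m], a product of truncated exponentials agrees with the exponential of the sum. *)
have coefE d (z : 'I_d -> A) e : (e <= m)%N ->
    (\prod_i E (z i))`_e = (e`!%:R : F)^-1 *: (\sum_i z i) ^+ e.
  elim: d z e => [|d IH] z e le_em.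
    rewrite !big_ord0 coef1 expr0n.
    by case: e le_em => [|e] _ /=; rewrite ?invr1 ?scale1r ?scaler0.
  rewrite !big_ord_recl coefM -exprDn_fact; apply: eq_bigr => i _.
  have le_ie : (i <= e)%N by rewrite -ltnS.
  rewrite coef_poly ltnS (leq_trans le_ie le_em) IH //.
  exact: leq_trans (leq_subr _ _) le_em.
have k0 : (k`!%:R : F) != 0 by rewrite pnatr_eq0 -lt0n fact_gt0.
rewrite -[LHS]scale1r -[X in X *: _ = _](mulfV k0) -scalerA.
rewrite -(coefE _ _ _ le_km).
under eq_bigr do rewrite /E poly_def.
rewrite bigA_distr_bigA /= coef_sum scaler_sumr [RHS]big_mkcond.
apply: eq_bigr => t _; rewrite scaler_prod prodrXr coefZ coefXn eq_sym.
case: eqP => _; rewrite ?mulr0 ?scaler0 // mulr1 scaler_prod scalerA.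
by rewrite -prodfV.
Qed.

(** Modulo ['X^n.+1], [f] is [1 - u] with [u] divisible by ['X]; thus [u ^+ n.+1] vanishes and the
    finite geometric sum inverts [f]. *)
Lemma fps_left_inverse_geometric (F : fieldType) (f g : fps F) (n : nat) :
  fps_mul g f =1 fps_one F -> f 0%N = 1 ->
  g n = \sum_(k < n.+1) ((\sum_(i < n) (- f i.+1) *: 'X^(i.+1)) ^+ k)`_n.
Proof.
move=> gf f0; set u := \sum_(i < n) _.
pose p := \poly_(i < n.+1) f i; pose q := \poly_(i < n.+1) g i.
have pE : p = 1 - u.
  rewrite /p poly_def big_ord_recl /= f0 scale1r expr0 -sumrN.
  by congr (_ + _); apply: eq_bigr => i _; rewrite scaleNr opprK.
have uX : u = (\sum_(i < n) (- f i.+1) *: 'X^i) * 'X.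
  rewrite mulr_suml; apply: eq_bigr => i _.
  by rewrite exprSr scalerAl.
have qp i : (i <= n)%N -> (q * p)`_i = (1 : {poly F})`_i.
  move=> le_in; rewrite coefM coef1 -[RHS]/(fps_one F i) -gf.
  apply: eq_bigr => j _; have le_ji : (j <= i)%N by rewrite -ltnS.
  by rewrite !coef_poly !ltnS (leq_trans le_ji) ?(leq_trans (leq_subr _ _)).
have un i : (i <= n)%N -> (1 - u ^+ n.+1)`_i = (1 : {poly F})`_i.
  by move=> le_in; rewrite coefB uX exprMn coefMXn ltnS le_in subr0.
rewrite -coef_sum; set S := \sum_(k < n.+1) _.
have pS : p * S = 1 - u ^+ n.+1.
  by rewrite pE -opprB mulNr -subrX1 opprB.
have <- : q`_n = g n by rewrite coef_poly ltnS leqnn.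
(* Uniqueness of the inverse: modulo ['X^n.+1], q = q(pS) = (qp)S = S. *)
rewrite -[q]mulr1 -[S]mul1r.
rewrite -(@eq_coefM _ q (1 - u ^+ n.+1) _ _ n) // -pS mulrA.
exact: eq_coefM.
Qed.

Lemma fps_left_inverse_multinomial (F : numFieldType) (f g : fps F) (n : nat) :
  fps_mul g f =1 fps_one F -> f 0%N = 1 ->
  g n =
  \sum_(t : {ffun 'I_n -> 'I_n.+1} | (\sum_(i < n) i.+1 * t i)%N == n)
     ((\sum_(i < n) t i)%N`!%:R / \prod_(i < n) (t i)`!%:R)
     * \prod_(i < n) (- f i.+1) ^+ t i.
Proof.
move=> gf f0; rewrite (@fps_left_inverse_geometric _ f) //.
pose w (t : {ffun 'I_n -> 'I_n.+1}) : F :=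
  (\sum_(i < n) t i)%N`!%:R / \prod_(i < n) (t i)`!%:R
  * \prod_(i < n) (- f i.+1) ^+ t i.
(* Sort the [t] by their total, which is the exponent [k] in the geometric sum. *)
transitivity (\sum_(k < n.+1)
    \sum_(t : {ffun 'I_n -> 'I_n.+1} | ((\sum_(i < n) i.+1 * t i)%N == n)
       && (inord (\sum_i t i)%N == k)) w t); last first.
  pose s (t : {ffun 'I_n -> 'I_n.+1}) : 'I_n.+1 := inord (\sum_i t i)%N.
  by rewrite -(partition_big s predT).
apply: eq_bigr => k _; have le_kn : (k <= n)%N by rewrite -ltnS.
rewrite (@multinomial_expansion F {poly F} n n) // coef_sum.
rewrite big_mkcond [RHS]big_mkcond; apply: eq_bigr => t _.
have -> : \prod_(i < n) ((- f i.+1) *: 'X^(i.+1)) ^+ t i =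
    (\prod_(i < n) (- f i.+1) ^+ t i) *: 'X^(\sum_(i < n) i.+1 * t i)%N.
  by rewrite -prodrXr -scaler_prod; apply: eq_bigr => i _; rewrite exprZn exprM.
rewrite !coefZ coefXn [n == _]eq_sym.
case: (eqVneq (\sum_(i < n) i.+1 * t i)%N n) => [tn|_]; last first.
  by rewrite !mulr0; case: ifP.
(* Every weight [i.+1] is at least 1, so the total is at most [n] and [inord] returns it
   unchanged. *)
have le_tn : (\sum_i t i <= n)%N.
  by rewrite -[leqRHS]tn leq_sum // => i _; rewrite leq_pmull.
rewrite -val_eqE /= inordK ?ltnS //.
by case: eqP => // <-; rewrite mulr1.
Qed.

Theorem theorem3 (N r n : nat) (hN : (0 < N)%N) (hr : (0 < r)%N)
    (hn : (0 < n)%N) :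
  [/\ hgCauchy N r n =
        n`!%:R *
        \sum_(t : {ffun 'I_n -> 'I_n.+1} | (\sum_(i < n) i.+1 * t i)%N == n)
           ((\sum_(i < n) t i)%N`!%:R / \prod_(i < n) (t i)`!%:R)
           * (-1) ^+ (n - \sum_(i < n) t i)%N
           * \prod_(i < n) Dsum N r i.+1 ^+ t i,
      Dsum N r n =
        \det (\matrix_(i < n, j < n)
                (if (j <= i)%N then
                   hgCauchy N r (i - j + 1)%N / (i - j + 1)%N`!%:R
                 else if j == i.+1 :> nat then 1 else 0))
    & let C : 'M[rat]_n.+1 := \matrix_(i, j)
        (if (j <= i)%N then hgCauchy N r (i - j)%N / (i - j)%N`!%:R else 0) in
      [/\ Dsum N r 0 = 1, C \in unitmx
        & invmx C = \matrix_(i, j)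
            (if (j <= i)%N then (-1) ^+ (i - j)%N * Dsum N r (i - j)%N
             else 0)]].
Proof.
pose c : fps rat := fun k => hgCauchy N r k / k`!%:R.
pose d : fps rat := fun k => (-1) ^+ k * Dsum N r k.
have cd : fps_mul c d =1 fps_one rat.
  move=> k; rewrite -(hgCauchyP r hN); apply: eq_bigr => i _.
  by rewrite gauss_exp_Dsum.
have D0 : Dsum N r 0 = 1.
  have := gauss_exp_Dsum N r 0 hN; rewrite expr0 mul1r => <-.
  by rewrite fps_exp0 gaussE // addn0 mul1r divff ?expr1n // pnatr_eq0 -lt0n.
have d0 : d 0%N = 1 by rewrite /d D0 mulr1.
(* Parts (2) and (3) need the product in this order; reversing the summation index supplies it. *)
have dc : fps_mul d c =1 fps_one rat.
  move=> k; rewrite -cd /fps_mul (reindex_inj rev_ord_inj) /=.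
  apply: eq_bigr => i _; rewrite subSS mulrC subKn //.
  by rewrite -ltnS.
have c0 : c 0%N = 1.
  by have := cd 0%N; rewrite /fps_mul big_ord1 d0 mulr1.
split.
- have n0 : (n`!%:R : rat) != 0 by rewrite pnatr_eq0 -lt0n fact_gt0.
  have -> : hgCauchy N r n = n`!%:R * c n by rewrite mulrC divfK.
  rewrite (fps_left_inverse_multinomial rat d c n cd d0); congr (_ * _).
  apply: eq_bigr => t /eqP tn; rewrite -[RHS]mulrA; congr (_ * _).
  have le_tn : (\sum_i t i <= n)%N.
    by rewrite -[leqRHS]tn leq_sum // => i _; rewrite leq_pmull.
  have -> : \prod_(i < n) (- d i.+1) ^+ t i =
      \prod_(i < n) ((-1) ^+ (i.+2 * t i) * Dsum N r i.+1 ^+ t i).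
    apply: eq_bigr => i _.
    by rewrite exprM -exprMn [(-1) ^+ i.+2]exprS mulN1r mulNr.
  rewrite prodr_signM; congr (_ * _).
  (* The sign exponent becomes [\sum_i t i + n], of the same parity as [n - \sum_i t i]. *)
  under eq_bigr do rewrite mulSn.
  by rewrite big_split /= tn -signr_odd -[RHS]signr_odd oddD oddB // addbC.
(* The sign inside [d n] cancels the [(-1) ^+ n] of the determinant formula. *)
- rewrite [RHS](det_hessenberg_toeplitz rat n c d c0 dc) mulrA -exprD addnn.
  by rewrite -signr_odd odd_double mul1r.
- move=> C; have CD : C *m fps_toeplitz rat n.+1 d = 1%:M.
    rewrite [C](_ : _ = fps_toeplitz rat n.+1 c) // fps_toeplitzM.
    by rewrite -fps_toeplitz1; apply/matrixP => i j; rewrite !mxE dc.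
  have [uC _] := mulmx1_unit CD.
  by split=> //; rewrite -[LHS]mulmx1 -CD mulKmx.
Qed.
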